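(* Let $(X,\delta)$ be a separable normal approach space. Suppose $L\subseteq X$ is a subset for which there exists $\gamma>0$ such that for all $A\subseteq L$ the sets $A$ and $L\setminus A$ are $\gamma$-separated in $(X,\delta)$. Then $2^{|L|}\le 2^{\aleph_0}$.
   Context: A distance on a set $X$ is a function $\delta:X\times 2^X\to[0,\infty]$ such that for all $x\in X$, $A,B\subseteq X$, $\varepsilon\in[0,\infty]$: (D1) $\delta(x,\{x\})=0$; (D2) $\delta(x,\emptyset)=\infty$; (D3) $\delta(x,A\cup B)=\min\{\delta(x,A),\delta(x,B)\}$; (D4) $\delta(x,A)\le\delta(x,A^{(\varepsilon)})+\varepsilon$, where $A^{(\varepsilon)}=\{x\in X\mid\delta(x,A)\le\varepsilon\}$. The pair $(X,\delta)$ is an approach space. Its underlying topology is the one with closure operator $\mathrm{cl}(A)=A^{(0)}=\{x\mid\delta(x,A)=0\}$. $(X,\delta)$ is separable if its underlying topology is separable. For a real $\gamma>0$, sets $A,B\subseteq X$ are $\gamma$-separated if $A^{(\alpha)}\cap B^{(\beta)}=\emptyset$ whenever $\alpha\ge0$, $\beta\ge0$ and $\alpha+\beta<\gamma$. A contractive scale is a map $F:\mathbb Q\to 2^X$ with $\bigcup_{q\in\mathbb Q}F(q)=X$ and $\bigcap_{q\in\mathbb Q}F(q)=\emptyset$ such that for all rationals $r<s$ the sets $F(r)$ and $X\setminus F(s)$ are $(s-r)$-separated. $(X,\delta)$ is normal if for all $A,B\subseteq X$ and all real $\gamma>0$ with $A$ and $B$ $\gamma$-separated, there exists a contractive scale $F$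 such that (i) $F(q)=\emptyset$ for all rational $q<0$; (ii) $A\subseteq\bigcap_{q\in\mathbb Q,\,q\ge0}F(q)$; (iii) $B\cap\bigcup_{r\in\mathbb Q\cap\,]0,\gamma]}F(r)=\emptyset$. *)

(* Defs.v *)
From HB Require Import structures.
From mathcomp Require Import all_boot all_order all_algebra.
From mathcomp Require Import all_classical all_reals all_analysis.

Set Implicit Arguments.
Unset Strict Implicit.
Unset Printing Implicit Defensive.

Import Order.TTheory GRing.Theory Num.Theory.

Local Open Scope classical_set_scope.
Local Open Scope ring_scope.
Local Open Scope ereal_scope.

(* The set A^(e), for an arbitrary e in [0, +oo]. *)
Definition enlargement (R : realType) (X : Type) (d : X -> set X -> \bar R)
    (A : set X) (e : \bar R) : set X :=
  [set x | d x A <= e].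

Record distance (R : realType) (X : Type) := Distance {
  dist :> X -> set X -> \bar R;
  dist_ge0 : forall x A, 0 <= dist x A;
  dist_set1 : forall x, dist x [set x] = 0;
  dist_set0 : forall x, dist x set0 = +oo;
  dist_setU : forall x A B,
    dist x (A `|` B) = Order.min (dist x A) (dist x B);
  dist_enlargement : forall x A e, 0 <= e ->
    dist x A <= dist x (enlargement dist A e) + e
}.

Section underlying_topology.
Context {R : realType} {X : Type} (d : distance R X).

Definition approach_cl (A : set X) : set X := enlargement d A 0.

Lemma approach_clE (A : set X) : approach_cl A = [set x | d x A = 0].
Proof.
apply/seteqP; split=> x; rewrite /approach_cl /enlargement /=.
  by move=> dA; apply/eqP; rewrite eq_le dA dist_ge0.
by move=> ->.
Qed.

Lemma dist_anti x (A B : set X) : A `<=` B -> d x B <= d x A.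
Proof. by move=> /setUidPr <-; rewrite dist_setU ge_min lexx. Qed.

Lemma sub_approach_cl (A : set X) : A `<=` approach_cl A.
Proof.
move=> x Ax; rewrite /approach_cl /enlargement /= -(dist_set1 d x).
by apply: dist_anti => _ ->.
Qed.

Lemma approach_clS (A B : set X) : A `<=` B -> approach_cl A `<=` approach_cl B.
Proof. by move=> AB x; apply: le_trans; exact: dist_anti. Qed.

Lemma approach_cl_idem (A : set X) :
  approach_cl (approach_cl A) `<=` approach_cl A.
Proof.
move=> x; apply: le_trans.
by rewrite -[leRHS]adde0; exact: dist_enlargement.
Qed.

Definition approach_open (U : set X) : Prop := approach_cl (~` U) = ~` U.

Lemma approach_openP (U : set X) :
  approach_open U <-> approach_cl (~` U) `<=` ~` U.
Proof.
split; first by move=> ->.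
by move=> h; apply/seteqP; split=> //; exact: sub_approach_cl.
Qed.

Lemma approach_openT : approach_open setT.
Proof.
apply/approach_openP => x; rewrite setCT /approach_cl /enlargement /=.
by rewrite dist_set0.
Qed.

Lemma approach_openI : setI_closed approach_open.
Proof.
move=> A B /approach_openP oA /approach_openP oB; apply/approach_openP => x.
rewrite setCI /approach_cl /enlargement /= dist_setU ge_min.
by case/orP => [/oA|/oB]; [left|right].
Qed.

Lemma approach_open_bigU (I : Type) (f : I -> set X) :
  (forall i, approach_open (f i)) -> approach_open (\bigcup_i f i).
Proof.
move=> of_; apply/approach_openP => x clx [i _ fix_].
have /approach_openP /(_ x) := of_ i; apply => //.
by apply: approach_clS clx => y nfy fiy; apply: nfy; exists i.
Qed.

End underlying_topology.

(* The points of X, carrying the underlying topology of the distance d. *)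
Definition approach_space (R : realType) (X : Type) (d : distance R X) : Type :=
  X.

HB.instance Definition _ (R : realType) (X : Type) (d : distance R X) :=
  gen_eqMixin (approach_space d).
HB.instance Definition _ (R : realType) (X : Type) (d : distance R X) :=
  gen_choiceMixin (approach_space d).
HB.instance Definition _ (R : realType) (X : Type) (d : distance R X) :=
  isOpenTopological.Build (approach_space d) (approach_openT d)
    (@approach_openI R X d) (@approach_open_bigU R X d).

Lemma closure_approach_cl (R : realType) (X : Type) (d : distance R X)
    (A : set (approach_space d)) :
  closure A = approach_cl d A.
Proof.
apply/seteqP; split=> x.
  rewrite closureE => /(_ (approach_cl d A)); apply; split; last first.
    exact: sub_approach_cl.
  rewrite -openC; apply/approach_openP; rewrite setCK.
  exact: approach_cl_idem.
rewrite closureE => clx B [cB AB].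
move: cB; rewrite -openC => /approach_openP; rewrite setCK; apply.
exact: approach_clS AB _ clx.
Qed.

Definition separable_space (T : topologicalType) : Prop :=
  exists2 D : set T, countable D & dense D.

Definition gamma_separated (R : realType) (X : Type) (d : distance R X)
    (gamma : R) (A B : set X) : Prop :=
  forall alpha beta : R, (0 <= alpha)%R -> (0 <= beta)%R ->
    (alpha + beta < gamma)%R ->
    enlargement d A alpha%:E `&` enlargement d B beta%:E = set0.

Definition contractive_scale (R : realType) (X : Type) (d : distance R X)
    (F : rat -> set X) : Prop :=
  [/\ \bigcup_q F q = setT,
      \bigcap_q F q = set0 &
      forall r s : rat, (r < s)%R ->
        gamma_separated d (ratr (s - r)) (F r) (~` F s)].

Definition normal_approach (R : realType) (X : Type) (d : distance R X) : Prop :=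
  forall (A B : set X) (gamma : R), (0 < gamma)%R -> gamma_separated d gamma A B ->
  exists F : rat -> set X,
    [/\ contractive_scale d F,
        forall q : rat, (q < 0)%R -> F q = set0,
        A `<=` \bigcap_(q in [set q : rat | (0 <= q)%R]) F q &
        B `&` \bigcup_(r in [set r : rat | (0 < r)%R /\ (ratr r <= gamma)%R]) F r
          = set0].

(* Main.v *)
Require Import Defs.
From mathcomp Require Import all_boot all_order all_algebra.
From mathcomp Require Import all_classical all_reals all_analysis.

(** This is Jones' lemma.  Normality applied to [A] and [L `\` A], for
    [A `<=` L], yields a contractive scale; the gap between two of its rational
    levels makes a member [V] of that scale a topological separator, with [A]
    inside the interior of [V] and the closure of [V] missing [L `\` A]
    ([normal_separator]).  Now let [D] be countable and dense.  As every point
    of [V°] is adherent to [V `&` D] ([dense_interior_closure]), the subset [A]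
    is recovered from the trace of its separator on [D], namely
    [A = L `&` closure (V `&` D)].  Hence there are at most as many subsets of
    [L] as subsets of the countable set [D] ([jones_lemma]). *)

Import Order.TTheory GRing.Theory Num.Theory.

Set Implicit Arguments.

Local Open Scope classical_set_scope.
Local Open Scope card_scope.
Local Open Scope ring_scope.

Lemma dense_interior_closure (T : topologicalType) (D V : set T) :
  dense D -> V° `<=` closure (V `&` D).
Proof.
move=> dD x Vx B Bx.
have [||y [[Vy By] Dy]] := dD (V° `&` B°).
- by exists x; split=> //; exact: Bx.
- by apply: openI; exact: open_interior.
- by exists y; split; [split=> //|]; exact: interior_subset.
Qed.

(** The map from sets of naturals to subsets of [L] goes in the decoding
    direction, from a trace on [D] to the set it determines: its surjectivity
    needs only the existence of a separator for each [A], so no choice of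
    separators has to be made. *)
Lemma jones_lemma (T : topologicalType) (D L : set T) :
  countable D -> dense D ->
  (forall A, A `<=` L ->
    exists2 V : set T, A `<=` V° & closure V `&` (L `\` A) = set0) ->
  [set A | A `<=` L] #<= [set: set nat].
Proof.
move=> /countable_injP[g ginj] dD sepL.
pose decode (S : set nat) := L `&` closure (D `&` g @^-1` S).
suff decode_onto : [set A | A `<=` L] `<=` decode @` setT.
  exact: card_le_trans (subset_card_le decode_onto) (card_image_le _ _).
move=> A AL; have [V AV VLA] := sepL A AL.
exists (g @` (V `&` D)) => //; rewrite /decode.
have -> : D `&` g @^-1` (g @` (V `&` D)) = V `&` D.
  apply/seteqP; split=> [y [Dy [z [Vz Dz] gzy]]|y [Vy Dy]].
    by rewrite -(ginj z y _ _ gzy) ?inE.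
  by split=> //; exists y.
apply/seteqP; split=> [x [Lx clx]|x Ax]; last first.
  by split; [exact: AL|exact/(@dense_interior_closure _ D V dD)/AV].
apply: contrapT => nAx.
suff : set0 x by [].
rewrite -VLA; split=> //.
by apply: closure_subset clx => y [].
Qed.

(** Separation with both enlargements taken at radius [0], where enlarging is
    taking the closure. *)
Lemma gamma_separated_closure (R : realType) (X : Type) (d : distance R X)
    (gamma : R) (A B : set (approach_space d)) :
  0 < gamma -> gamma_separated d gamma A B -> closure A `&` closure B = set0.
Proof.
move=> gamma0 sepAB; rewrite !closure_approach_cl.
by apply: sepAB; rewrite ?addr0.
Qed.

(** For a scale [F] adapted to [A] and [B], any level [F r] with
    [0 < r < gamma] separates: [A] lies in [F 0], whose closure is disjoint
    from that of the complement of [F r], while [B] lies in the complement of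
    [F s] for any rational [s] between [r] and [gamma]. *)
Lemma normal_separator (R : realType) (X : Type) (d : distance R X)
    (gamma : R) (A B : set (approach_space d)) :
  normal_approach d -> 0 < gamma -> gamma_separated d gamma A B ->
  exists2 V : set (approach_space d), A `<=` V° & closure V `&` B = set0.
Proof.
move=> hnorm gamma0 /(hnorm _ _ _ gamma0)[F [[_ _ scaleF] _ AF BF]].
pose V q : set (approach_space d) := F q.
have gapV r s : r < s -> closure (V r) `&` closure (~` V s) = set0.
  move=> rs; apply: gamma_separated_closure (scaleF r s rs).
  by rewrite ltr0q subr_gt0.
have [s] := rat_in_itvoo gamma0.
rewrite in_itv /= ltr0q => /andP[s0 sgamma].
have r0 : 0 < s / 2 by rewrite divr_gt0.
have rs : s / 2 < s by rewrite gtr_pMr // invf_lt1 // ltr1n.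
exists (V (s / 2)).
  move=> x Ax; rewrite -[V (s / 2)]setCK interiorC => clx.
  suff : set0 x by [].
  rewrite -(gapV _ _ r0); split=> //.
  by apply: subset_closure; exact: (AF x Ax 0 (lexx _)).
apply/seteqP; split=> // x [clx Bx].
rewrite -(gapV _ _ rs); split=> //; apply: subset_closure => Vsx.
suff : set0 x by [].
by rewrite -BF; split=> //; exists s => //; split=> //; exact: ltW.
Qed.

Unset Implicit Arguments.

Theorem proposition3p9 (R : realType) (X : Type) (d : distance R X)
    (hsep : separable_space (approach_space d)) (hnorm : normal_approach d)
    (L : set X)
    (hL : exists gamma : R, 0 < gamma /\
      forall A : set X, A `<=` L -> gamma_separated d gamma A (L `\` A)) :
  [set A : set X | A `<=` L] #<= [set: set nat].
Proof.
have [D cD dD] := hsep; have [gamma [gamma0 sepL]] := hL.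
apply: (@jones_lemma (approach_space d) D L cD dD) => A AL.
exact: normal_separator hnorm gamma0 (sepL A AL).
Qed.
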